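(* Let $(\omega,\Omega)$ be a regular almost-cosymplectic-contact structure on $M$ with dual pair $(E,\Lambda)$. A vector field $X$ on $M$ is an infinitesimal symmetry of the structure $(\omega,\Omega)$ (i.e. $L_X\omega=0$ and $L_X\Omega=0$) if and only if $X=X_{(\alpha,h)}$ for some closed 1-form $\alpha$ with $\alpha(E)=0$ and some function $h\in C^\infty(M)$ satisfying $$i_{\alpha^\sharp}d\omega+h\,i_Ed\omega+dh=0.$$
   Context: $M$ is a smooth manifold of dimension $2n+1$; everything is smooth. A regular almost-cosymplectic-contact structure on $M$ is a pair $(\omega,\Omega)$ of a 1-form $\omega$ and a 2-form $\Omega$ with $d\Omega=0$ and $\omega\wedge\Omega^n$ nowhere zero. Write $\Omega^\flat:TM\to T^*M$, $Y\mapsto Y^\flat=i_Y\Omega$, and for a bivector field $\Lambda$ write $\Lambda^\sharp:T^*M\to TM$, $\alpha\mapsto\alpha^\sharp=i_\alpha\Lambda$, i.e. $\beta(\alpha^\sharp)=\Lambda(\alpha,\beta)$. The dual pair $(E,\Lambda)$ is the unique pair of a vector field $E$ (the Reeb vector field) and a bivector field $\Lambda$ such that $(\Omega^\flat|_{\mathrm{Im}\,\Lambda^\sharp})^{-1}=\Lambda^\sharp|_{\mathrm{Im}\,\Omega^\flat}$, $i_E\omega=1$, $i_E\Omega=0$, $i_\omega\Lambda=0$. For a 1-form $\alpha$ and a function $h$ put $X_{(\alpha,h)}=\alpha^\sharp+hE$. Every vector field is of this form, with $h=\omega(X)$ and $\alpha$ determined up to adding a function multiple of $\omega$. $L$ denotes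 the Lie derivative. *)

(* Defs.v *)
From HB Require Import structures.
From mathcomp Require Import all_boot all_order all_fingroup all_algebra.
From mathcomp Require Import all_classical all_reals all_analysis.
Import Order.TTheory GRing.Theory Num.Theory.
Import numFieldNormedType.Exports.

Set Implicit Arguments.
Unset Strict Implicit.
Unset Printing Implicit Defensive.

Local Open Scope classical_set_scope.
Local Open Scope ring_scope.

(* [iter_derive f [:: v1; ...; vr]] is the iterated directional derivative
   D_v1 ... D_vr f. *)
Fixpoint iter_derive (R : realType) (V W : normedModType R) (f : V -> W)
    (vs : seq V) : V -> W :=
  if vs is v :: vs' then 'D_v (iter_derive f vs') else f.

(* C^infinity on U; intended for open U, where it amounts to the existence and
   continuity of all iterated partial derivatives. *)
Definition smooth_on (R : realType) (V W : normedModType R) (U : set V)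
    (f : V -> W) : Prop :=
  forall (vs : seq V) (x : V), U x -> differentiable (iter_derive f vs) x.

(* The smooth structure is given by a smooth atlas indexed by [chart].  Only
   the restriction of [chart_map c] to [chart_dom c] and that of its inverse
   [chart_inv c] to the image of [chart_dom c] are meaningful. *)
Record manifold (R : realType) (m : nat) := Manifold {
  pt :> topologicalType;
  chart : Type;
  chart_dom : chart -> set pt;
  chart_map : chart -> pt -> 'rV[R]_m;
  chart_inv : chart -> 'rV[R]_m -> pt;
  hausdorff_pt : hausdorff_space pt;
  second_countable_pt : @second_countable pt;
  chart_dom_open : forall c, open (chart_dom c);
  chart_dom_cover : forall p, exists c, chart_dom c p;
  chart_mapK : forall c p, chart_dom c p -> chart_inv c (chart_map c p) = p;
  chart_image_open : forall c, open (chart_map c @` chart_dom c);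
  chart_map_continuous :
    forall c, {within chart_dom c, continuous (chart_map c)};
  chart_inv_continuous :
    forall c, {within chart_map c @` chart_dom c, continuous (chart_inv c)};
  transition_smooth : forall c c',
    smooth_on (chart_map c @` (chart_dom c `&` chart_dom c'))
      (chart_map c' \o chart_inv c) }.

Arguments chart {R m} m0 : rename.
Arguments chart_dom {R m m0} c _ : rename.
Arguments chart_map {R m m0} c _ : rename.
Arguments chart_inv {R m m0} c _ : rename.

Section Tensors.
Context {R : realType} {m : nat} {M : manifold R m}.

Local Notation V := 'rV[R]_m.
Local Notation chart := (chart M).

Definition transition (c c' : chart) : V -> V := chart_map c' \o chart_inv c.

(* The local expression of a function on M in the chart c. *)
Definition local_expr (T : Type) (c : chart) (f : M -> T) : V -> T :=
  f \o chart_inv c.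

Definition smooth_in (W : normedModType R) (c : chart) (f : M -> W) : Prop :=
  smooth_on (chart_map c @` chart_dom c) (local_expr c f).

Definition smooth_fun (f : M -> R) : Prop := forall c : chart, smooth_in c f.

(* A tensor field is the family of its local expressions in the charts of the
   atlas, subject to the transformation law; the values at (c, p) with p
   outside of [chart_dom c] are irrelevant.

   In the chart c at p, a tangent vector is the row of its components on the
   coordinate basis, a k-form is a function of k such rows, and a bivector is
   the antisymmetric matrix of its components: Lambda(dx^i, dx^j) is the entry
   (i, j). *)
Definition vect_family := chart -> M -> V.
Definition form_family (k : nat) := chart -> M -> ('I_k -> V) -> R.
Definition bivect_family := chart -> M -> 'M[R]_m.

Definition multilinear_form (k : nat) (f : ('I_k -> V) -> R) : Prop :=
  forall (v : 'I_k -> V) (i : 'I_k) (a : R) (x y : V),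
    f [eta v with i |-> a *: x + y]
      = a * f [eta v with i |-> x] + f [eta v with i |-> y].

Definition alternating_form (k : nat) (f : ('I_k -> V) -> R) : Prop :=
  forall (v : 'I_k -> V) (i j : 'I_k), i != j -> v i = v j -> f v = 0.

Definition is_vect (X : vect_family) : Prop :=
  (forall c, smooth_in c (X c)) /\
  (forall c c' p, chart_dom c p -> chart_dom c' p ->
     X c' p = 'd (transition c c') (chart_map c p) (X c p)).

Definition is_form (k : nat) (w : form_family k) : Prop :=
  [/\ forall c v, smooth_in c (fun p => w c p v),
      forall c p, chart_dom c p -> multilinear_form (w c p),
      forall c p, chart_dom c p -> alternating_form (w c p) &
      forall c c' p v, chart_dom c p -> chart_dom c' p ->
        w c p v = w c' p (fun i => 'd (transition c c') (chart_map c p) (v i))].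

Definition is_bivect (L : bivect_family) : Prop :=
  [/\ forall c, smooth_in c (L c),
      forall c p, chart_dom c p -> (L c p)^T = - L c p &
      forall c c' p, chart_dom c p -> chart_dom c' p ->
        let J := jacobian (transition c c') (chart_map c p) in
        L c' p = J^T *m L c p *m J].

Record vect_field := VectField {
  vect_comp :> vect_family; vect_compP : is_vect vect_comp }.
Record kform (k : nat) := KForm {
  form_comp :> form_family k; form_compP : is_form form_comp }.
Record bivect_field := BivectField {
  bivect_comp :> bivect_family; bivect_compP : is_bivect bivect_comp }.

Definition vect_eq (X Y : vect_family) : Prop :=
  forall c p, chart_dom c p -> X c p = Y c p.

Definition form_eq (k : nat) (w w' : form_family k) : Prop :=
  forall c p v, chart_dom c p -> w c p v = w' c p v.

Definition zero_form (k : nat) : form_family k := fun _ _ _ => 0.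

Definition add_form (k : nat) (w w' : form_family k) : form_family k :=
  fun c p v => w c p v + w' c p v.

Definition scale_form (k : nat) (h : M -> R) (w : form_family k) :
    form_family k :=
  fun c p v => h p * w c p v.

(* A function seen as a 0-form. *)
Definition form0 (f : M -> R) : form_family 0 := fun _ p _ => f p.

(* (i_X w)(v_1, ..., v_k) = w(X, v_1, ..., v_k) *)
Definition iprod (k : nat) (X : vect_family) (w : form_family k.+1) :
    form_family k :=
  fun c p v => w c p (fun i => oapp v (X c p) (unlift ord0 i)).

(* (dw)(v_0, ..., v_k) = \sum_i (-1)^i D_(v_i) (w(v_0, .., ^v_i, .., v_k)) for
   vectors with constant components in the chart. *)
Definition ext_d (k : nat) (w : form_family k) : form_family k.+1 :=
  fun c p v => \sum_(i < k.+1)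
    (-1) ^+ i *
    'D_(v i) (local_expr c (fun q => w c q (fun j => v (lift i j))))
      (chart_map c p).

(* (L_X w)(v_1, ..., v_k)
     = X(w(v_1, ..., v_k)) - \sum_i w(v_1, .., [X, v_i], .., v_k)
   for vectors with constant components in the chart, for which
   [X, v] = - D_v X. *)
Definition lie_d (k : nat) (X : vect_family) (w : form_family k) :
    form_family k :=
  fun c p v =>
    'D_(X c p) (local_expr c (fun q => w c q v)) (chart_map c p) +
    \sum_(i < k)
      w c p [eta v with i |-> 'D_(v i) (local_expr c (X c)) (chart_map c p)].

(* Normalised so that (dx^1 /\ ... /\ dx^r)(e_1, ..., e_r) = 1. *)
Definition wedge_form (k l : nat) (a : form_family k) (b : form_family l) :
    form_family (k + l) :=
  fun c p v => (k`! * l`!)%:R^-1 *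
    \sum_(s : 'S_(k + l)) (-1) ^+ s *
      (a c p (fun i => v (s (lshift l i))) *
       b c p (fun j => v (s (rshift k j)))).

Fixpoint wedge_exp (k : nat) (w : form_family k) (n : nat) :
    form_family (n * k) :=
  match n return form_family (n * k) with
  | 0 => form0 (fun=> 1)
  | n'.+1 => wedge_form w (@wedge_exp k w n')
  end.

Definition nowhere_zero (k : nat) (w : form_family k) : Prop :=
  forall c p, chart_dom c p -> exists v, w c p v != 0.

Definition closed_form (k : nat) (w : form_family k) : Prop :=
  form_eq (ext_d w) (@zero_form k.+1).

(* The components of a 1-form on the basis dx^j, as a column. *)
Definition covector (a : form_family 1) (c : chart) (p : M) : 'cV[R]_m :=
  \col_j a c p (fun=> delta_mx 0 j).

(* Y |-> i_Y Omega, on the tangent space at p. *)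
Definition flat_at (Om : form_family 2) (c : chart) (p : M) (y : V) :
    'cV[R]_m :=
  \col_j Om c p (fun i : 'I_2 => if i == ord0 then y else delta_mx 0 j).

(* a |-> i_a Lambda, on the cotangent space at p: the vector with
   b(sharp a) = Lambda(a, b) for all covectors b. *)
Definition sharp_at (L : bivect_family) (c : chart) (p : M) (a : 'cV[R]_m) :
    V :=
  a^T *m L c p.

Definition sharp (L : bivect_family) (a : form_family 1) : vect_family :=
  fun c p => sharp_at L c p (covector a c p).

(* X_(a, h) *)
Definition pair_vect (E : vect_family) (L : bivect_family)
    (a : form_family 1) (h : M -> R) : vect_family :=
  fun c p => sharp L a c p + h p *: E c p.

Definition dual_pair (om : form_family 1) (Om : form_family 2)
    (E : vect_family) (L : bivect_family) : Prop :=
  [/\ forall c p, chart_dom c p ->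
        {in range (sharp_at L c p), cancel (flat_at Om c p) (sharp_at L c p)} /\
        {in range (flat_at Om c p), cancel (sharp_at L c p) (flat_at Om c p)},
      form_eq (iprod E om) (form0 (fun=> 1)),
      form_eq (iprod E Om) (@zero_form 1) &
      vect_eq (sharp L om) (fun _ _ => 0)].

Definition infinitesimal_symmetry (om : form_family 1) (Om : form_family 2)
    (X : vect_family) : Prop :=
  form_eq (lie_d X om) (@zero_form 1) /\ form_eq (lie_d X Om) (@zero_form 2).

End Tensors.

Arguments wedge_exp {R m M k} w n _ _ _.
Arguments vect_field {R m} M.
Arguments kform {R m} M k.
Arguments bivect_field {R m} M.

Definition regular_acc_structure (R : realType) (n : nat)
    (M : manifold R (2 * n).+1) (om : kform M 1) (Om : kform M 2) : Prop :=
  closed_form Om /\ nowhere_zero (wedge_form om (wedge_exp Om n)).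

(* Main.v *)
Require Import Defs.
From mathcomp Require Import all_boot all_order all_fingroup all_algebra.
From mathcomp Require Import all_classical all_reals all_analysis.

(** Two facts carry the proof.

    The first is pointwise. A tangent vector y with omega(y) = 0 and
    i_y Omega = 0 is contracted to 0 by omega /\ Omega^n; since this is a
    nonzero form of top degree, y = 0 ([vanishes_on_top_degree],
    [regular_nondegenerate]). The equations of the dual pair say that
    y - (y^flat)^sharp - omega(y) E is such a vector, whence the splitting
    y = (y^flat)^sharp + omega(y) E ([tangent_splitting]). Dually, a covector
    a with a(E) = 0 satisfies (a^sharp)^flat = a
    ([flat_sharp_annihilator]). Therefore X = alpha^sharp + h E with
    alpha(E) = 0 holds exactly when alpha = i_X Omega and h = omega(X).

    The second is Cartan's formula L_X = i_X d + d i_X ([cartan_formula]).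
    Since d Omega = 0 it gives L_X Omega = d alpha, and it gives
      L_X omega = i_(alpha^sharp) d omega + h i_E d omega + dh
    by linearity of i_X d omega in X. So the two conditions on the pair
    (alpha, h) are the two symmetry equations for X.

    Cartan's formula is computed in a chart, where d and L_X are differentiated
    on vectors with constant components: the only derivative to be expanded is
    that of w(X, u), with u constant, by the Leibniz rule applied to
    w(X, u) = \sum_j X^j w(e_j, u). The same expansion shows that i_X w is
    smooth. *)

Import Order.TTheory GRing.Theory Num.Theory.
Import numFieldNormedType.Exports.

Set Implicit Arguments.
Unset Strict Implicit.
Unset Printing Implicit Defensive.

Local Open Scope classical_set_scope.
Local Open Scope ring_scope.

(** * Smooth functions on open sets of a normed space *)

Section SmoothCalculus.
Context {R : realType}.

(** The differential at x is picked by a choice operator that depends on the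
    whole function, so it is not obviously the same for g; but that of f
    satisfies the requirements for g. *)
Lemma near_eq_differentiable (V W : normedModType R) (f g : V -> W) (x : V) :
  (\near x, f x = g x) -> differentiable f x -> differentiable g x.
Proof.
move=> fg dfx; have [dfC _] := (diffP _ _).1 dfx; apply/diffP.
apply: (@getPex _ (fun dg : {linear V -> W} => continuous dg /\
  forall y, g y = g (lim (nbhs x)) + dg (y - lim (nbhs x))
                  +o_(y \near x) (y - lim (nbhs x)))).
exists ('d f x); split=> //.
case: dfx => -[_]; rewrite lim_id // => /eqaddoP fo.
suff : g = cst (g x) + 'd f x \o center x +o_x (center x) by rewrite funeqE.
apply/eqaddoP => e e0.
have := fo e e0; apply: filter_app; near=> y.
move=> h; rewrite !fctE in h *.
suff -> : g y = f y by rewrite -(nbhs_singleton fg).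
by symmetry; near: y.
Unshelve. all: by end_near. Qed.

(** Iterated derivatives are built by adding a derivative at the head of the
    list, whereas inductions on smooth functions replace the function by its
    first derivative, the last one of the list. *)
Lemma iter_derive_rcons (V W : normedModType R) (f : V -> W) vs v :
  iter_derive f (rcons vs v) = iter_derive ('D_v f) vs.
Proof. by elim: vs => //= u vs ->. Qed.

Lemma eq_open_near (V W : normedModType R) (U : set V) (f g : V -> W) x :
  open U -> {in U, f =1 g} -> U x -> \near x, f x = g x.
Proof.
move=> oU fg Ux; near=> y; apply/fg/mem_set; near: y; exact: open_nbhs_nbhs.
Unshelve. all: by end_near. Qed.

Lemma eq_iter_derive (V W : normedModType R) (U : set V) (f g : V -> W) vs :
  open U -> {in U, f =1 g} -> {in U, iter_derive f vs =1 iter_derive g vs}.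
Proof.
move=> oU fg; elim: vs => [//|v vs IH] /= y yU.
exact/near_eq_derive/(eq_open_near oU IH)/set_mem.
Qed.

Lemma eq_smooth_on (V W : normedModType R) (U : set V) (f g : V -> W) :
  open U -> {in U, f =1 g} -> smooth_on U f -> smooth_on U g.
Proof.
move=> oU fg sf vs y Uy; apply: near_eq_differentiable (sf vs y Uy).
exact: (eq_open_near oU (eq_iter_derive vs oU fg)).
Qed.

Lemma smooth_on_differentiable (V W : normedModType R) (U : set V)
    (f : V -> W) x : smooth_on U f -> U x -> differentiable f x.
Proof. by move=> sf; exact: (sf [::]). Qed.

Lemma smooth_on_derive (V W : normedModType R) (U : set V) (f : V -> W) v :
  smooth_on U f -> smooth_on U ('D_v f).
Proof. by move=> sf vs; rewrite -iter_derive_rcons; exact: sf. Qed.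

Lemma deriveM_fun (V : normedModType R) (f g : V -> R) (x v : V) :
  differentiable f x -> differentiable g x ->
  'D_v (fun y => f y * g y) x = 'D_v f x * g x + f x * 'D_v g x.
Proof.
move=> df dg; rewrite [LHS]deriveM; do ?exact: diff_derivable.
by rewrite addrC; congr (_ + _); rewrite mulrC.
Qed.

Lemma derive_linear_fun (V : normedModType R) (a : R) (f g : V -> R) (x v : V) :
  differentiable f x -> differentiable g x ->
  'D_v (fun y => a * f y + g y) x = a * 'D_v f x + 'D_v g x.
Proof.
move=> /diff_derivable-/(_ v) df /diff_derivable-/(_ v) dg.
have daf := derivableZ (k := a) df.
by rewrite [LHS]deriveD // [X in X + _]deriveZ.
Qed.

Lemma derive_sum_fun (V : normedModType R) n (f : 'I_n -> V -> R) (x v : V) :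
  (forall i, differentiable (f i) x) ->
  'D_v (fun y => \sum_(i < n) f i y) x = \sum_(i < n) 'D_v (f i) x.
Proof.
move=> df; rewrite -derive_sum => [|i]; last exact: diff_derivable.
by congr ('D_v _ x); apply/funext => y; rewrite fct_sumE.
Qed.

Lemma derive_sum_mul (V : normedModType R) n (f g : 'I_n -> V -> R) (x v : V) :
  (forall i, differentiable (f i) x) -> (forall i, differentiable (g i) x) ->
  'D_v (fun y => \sum_(i < n) f i y * g i y) x
    = \sum_(i < n) ('D_v (f i) x * g i x + f i x * 'D_v (g i) x).
Proof.
move=> df dg; rewrite derive_sum_fun => [|i]; last exact: differentiableM.
by apply: eq_bigr => i _; rewrite deriveM_fun.
Qed.

(** The sum is there to make the induction on the number of derivatives work:
    by the Leibniz rule, a derivative of a sum of n products is again a sum of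
    products, of length n + n. *)
Lemma smooth_on_sum_mul (V : normedModType R) (U : set V) n
    (f g : 'I_n -> V -> R) :
  open U -> (forall i, smooth_on U (f i)) -> (forall i, smooth_on U (g i)) ->
  smooth_on U (fun y => \sum_(i < n) f i y * g i y).
Proof.
move=> oU sf sg vs.
elim/last_ind: vs n f g sf sg => [|vs v IH] n f g sf sg x Ux.
  rewrite /= (_ : (fun _ => _) = \sum_(i < n) (f i * g i)); last first.
    by apply/funext => y; rewrite fct_sumE.
  apply: differentiable_sum => i.
  by apply: differentiableM; exact: smooth_on_differentiable Ux.
rewrite iter_derive_rcons.
pose f' (i : 'I_(n + n)) :=
  match fintype.split i with inl j => 'D_v (f j) | inr j => f j end.
pose g' (i : 'I_(n + n)) :=
  match fintype.split i with inl j => g j | inr j => 'D_v (g j) end.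
have sf' i : smooth_on U (f' i).
  by rewrite /f'; case: fintype.split => j //; exact: smooth_on_derive.
have sg' i : smooth_on U (g' i).
  by rewrite /g'; case: fintype.split => j //; exact: smooth_on_derive.
apply: near_eq_differentiable (IH _ f' g' sf' sg' x Ux).
apply: (eq_open_near oU) Ux; apply: eq_iter_derive => // y /set_mem Uy.
have df i : differentiable (f i) y by exact: smooth_on_differentiable Uy.
have dg i : differentiable (g i) y by exact: smooth_on_differentiable Uy.
rewrite big_split_ord /= derive_sum_mul // -big_split; apply: eq_bigr => i _.
by rewrite /f' /g' !(unsplitK (inl i)) !(unsplitK (inr i)).
Qed.

Lemma derive_coord (V : normedModType R) m (f : V -> 'rV[R]_m) (x v : V) j :
  differentiable f x -> 'D_v (fun y => f y 0 j) x = ('D_v f x) 0 j.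
Proof. by move=> df; rewrite derive_mx ?mxE //; exact: diff_derivable. Qed.

Lemma differentiable_coord_fun (V : normedModType R) m (f : V -> 'rV[R]_m)
    (x : V) j : differentiable f x -> differentiable (fun y => f y 0 j) x.
Proof.
move=> df; apply: (@differentiable_comp _ _ _ _ f (fun N => N 0 j)) => //.
exact: differentiable_coord.
Qed.

Lemma smooth_on_coord (V : normedModType R) m (U : set V)
    (f : V -> 'rV[R]_m) j :
  open U -> smooth_on U f -> smooth_on U (fun y => f y 0 j).
Proof.
move=> oU sf vs; elim/last_ind: vs f sf => [|vs v IH] f sf x Ux.
  exact/differentiable_coord_fun/(smooth_on_differentiable sf Ux).
rewrite iter_derive_rcons.
apply: near_eq_differentiable (IH _ (smooth_on_derive v sf) x Ux).
apply: (eq_open_near oU) Ux; apply: eq_iter_derive => // y /set_mem Uy.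
by rewrite derive_coord //; exact: (smooth_on_differentiable sf Uy).
Qed.
End SmoothCalculus.

(** * Alternating multilinear forms *)

Section MultilinearAlgebra.
Context {R : realType} {m : nat}.
Local Notation V := 'rV[R]_m.

Lemma set_slot_id k (v : 'I_k -> V) i :
  [eta v with i |-> v i] = v :> ('I_k -> V).
Proof. by apply/funext => j /=; case: eqVneq => [->|]. Qed.

Lemma multilinear_sum k (f : ('I_k -> V) -> R) (v : 'I_k -> V) i n
    (a : 'I_n -> R) (x : 'I_n -> V) :
  multilinear_form f ->
  f [eta v with i |-> \sum_(j < n) a j *: x j]
    = \sum_(j < n) a j * f [eta v with i |-> x j].
Proof.
move=> fML; elim: n a x => [|n IH] a x.
  rewrite !big_ord0; have := fML v i (- 1) 0 0.
  by rewrite scaler0 addr0 mulN1r addNr.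
by rewrite !big_ord_recl fML IH.
Qed.

Lemma multilinear_coord k (f : ('I_k -> V) -> R) (v : 'I_k -> V) i x :
  multilinear_form f ->
  f [eta v with i |-> x]
    = \sum_(j < m) x 0 j * f [eta v with i |-> delta_mx 0 j].
Proof. by move=> fML; rewrite {1}(row_sum_delta x) multilinear_sum. Qed.

(** Polarisation: f vanishes when the same vector x + y is put in the slots i
    and j. *)
Lemma alternating_tperm k (f : ('I_k -> V) -> R) (v : 'I_k -> V) i j :
  multilinear_form f -> alternating_form f -> i != j ->
  f (v \o tperm i j) = - f v.
Proof.
move=> fML fA ij.
pose w x y : 'I_k -> V := [eta [eta v with i |-> x] with j |-> y].
have wl a x y z : f (w (a *: x + y) z) = a * f (w x z) + f (w y z).
  have wC x' z' :
      w x' z' = [eta [eta v with j |-> z'] with i |-> x'] :> ('I_k -> V).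
    apply/funext => l; rewrite /w /=; case: (eqVneq l j) => // ->.
    by rewrite eq_sym (negbTE ij).
  by rewrite !wC fML.
have wr a x y z : f (w z (a *: x + y)) = a * f (w z x) + f (w z y).
  exact: fML.
have w0 x : f (w x x) = 0.
  by apply: (fA _ i j) => //; rewrite /w /= eqxx (negbTE ij) eqxx.
have -> : v \o tperm i j = w (v j) (v i).
  apply/funext => l; rewrite /w /=; case: tpermP => [->|->|].
  - by rewrite (negbTE ij) eqxx.
  - by rewrite eqxx.
  - by move=> /eqP/negbTE -> /eqP/negbTE ->.
have vE : w (v i) (v j) = v.
  apply/funext => l; rewrite /w /=; case: (eqVneq l j) => [->//|_].
  by case: (eqVneq l i) => [->|].
have := w0 (1 *: v i + v j); rewrite wl !wr !w0 !mul1r add0r addr0 addrC vE.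
by move/eqP; rewrite addr_eq0 => /eqP.
Qed.

Lemma alternating_perm k (f : ('I_k -> V) -> R) (v : 'I_k -> V) (s : 'S_k) :
  multilinear_form f -> alternating_form f -> f (v \o s) = (-1) ^+ s * f v.
Proof.
move=> fML fA; have [ts -> ] := prod_tpermP s.
elim: ts v => [|t ts IH] v /=.
  rewrite big_nil odd_perm1 mul1r => _; congr f.
  by apply/funext => i /=; rewrite perm1.
move=> /andP[dt dts]; rewrite big_cons odd_mul_tperm dt.
have -> : v \o (tperm t.1 t.2 * \prod_(t <- ts) tperm t.1 t.2)%g =
    (v \o (\prod_(t <- ts) tperm t.1 t.2)%g) \o tperm t.1 t.2.
  by apply/funext => i /=; rewrite permM.
by rewrite alternating_tperm // IH // signr_addb mulN1r mulNr.
Qed.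

(** [vcons (X c p) v] is convertible to the argument of the form in
    [iprod X w c p v]. *)
Definition vcons k (x : V) (v : 'I_k -> V) : 'I_k.+1 -> V :=
  fun i => oapp v x (unlift ord0 i).

Lemma vcons0 k x (v : 'I_k -> V) : vcons x v ord0 = x.
Proof. by rewrite /vcons unlift_none. Qed.

Lemma vconsS k x (v : 'I_k -> V) i : vcons x v (lift ord0 i) = v i.
Proof. by rewrite /vcons liftK. Qed.

Lemma vcons_slot0 k x y (v : 'I_k -> V) :
  [eta vcons y v with ord0 |-> x] = vcons x v :> ('I_k.+1 -> V).
Proof.
apply/funext => j; case: (unliftP ord0 j) => [i|] -> /=.
  by rewrite !vconsS.
by rewrite vcons0.
Qed.

Lemma vcons_slotS k x y (v : 'I_k -> V) i :
  vcons y [eta v with i |-> x]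
    = [eta vcons y v with lift ord0 i |-> x] :> ('I_k.+1 -> V).
Proof.
apply/funext => j; case: (unliftP ord0 j) => [l|] -> /=.
  by rewrite !vconsS (inj_eq lift_inj).
by rewrite !vcons0.
Qed.

Lemma multilinear_vcons k (f : ('I_k.+1 -> V) -> R) x :
  multilinear_form f -> multilinear_form (fun v => f (vcons x v)).
Proof. by move=> fML v i a y z; rewrite !vcons_slotS. Qed.

Lemma alternating_vcons k (f : ('I_k.+1 -> V) -> R) x :
  alternating_form f -> alternating_form (fun v => f (vcons x v)).
Proof.
move=> fA v i j ij vij; apply: (fA _ (lift ord0 i) (lift ord0 j)).
  by rewrite (inj_eq lift_inj).
by rewrite !vconsS.
Qed.

Lemma vcons_coord k (f : ('I_k.+1 -> V) -> R) (v : 'I_k -> V) x :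
  multilinear_form f ->
  f (vcons x v) = \sum_(j < m) x 0 j * f (vcons (delta_mx 0 j) v).
Proof.
move=> fML; rewrite -(vcons_slot0 x 0) multilinear_coord //.
by apply: eq_bigr => j _; rewrite vcons_slot0.
Qed.

(** Moving the slot i to the front is a cycle of signature (-1)^i. This sign
    is the one in the definition of [ext_d]. *)
Lemma alternating_move_slot k (f : ('I_k.+1 -> V) -> R) (v : 'I_k.+1 -> V) i x :
  multilinear_form f -> alternating_form f ->
  f (vcons x (v \o lift i)) = (-1) ^+ i * f [eta v with i |-> x].
Proof.
move=> fML fA.
have -> : vcons x (v \o lift i) = [eta v with i |-> x] \o lift_perm ord0 i 1%g.
  apply/funext => j; case: (unliftP ord0 j) => [l|] -> /=.
    by rewrite vconsS lift_perm_lift perm1 /= eq_sym (negbTE (neq_lift _ _)).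
  by rewrite vcons0 lift_perm_id eqxx.
by rewrite alternating_perm // odd_lift_perm odd_perm1 addbF signr_odd.
Qed.

Definition vanishes_on k (y : V) (f : ('I_k -> V) -> R) :=
  forall v i, v i = y -> f v = 0.

(** The k + 1 vectors y, v_1, ..., v_k of an m-dimensional space are linearly
    dependent, and since y <> 0 some v_i has a nonzero coefficient c in the
    relation. Putting the (null) linear combination in the slot i of f(v)
    kills all of its terms but c f(v): the one in y by hypothesis, the other
    ones because two slots are equal. *)
Lemma vanishes_on_top_degree k (y : V) (f : ('I_k -> V) -> R) :
  (m <= k)%N -> multilinear_form f -> alternating_form f ->
  y != 0 -> vanishes_on y f -> forall v, f v = 0.
Proof.
move=> mk fML fA y0 fy v.
pose A : 'M[R]_(1 + k, m) := col_mx y (\matrix_(i < k) v i).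
have /rowV0Pn[u /sub_kermxP uA u0] : kermx A != 0.
  rewrite kermx_eq0 /row_free neq_ltn (leq_ltn_trans (rank_leq_col A)) //.
(* otherwise the relation reads u_0 y = 0 *)
have [i ui0] : exists i : 'I_k, u 0 (rshift 1 i) != 0.
  apply/existsP; apply: contra_neqT u0 => /existsPn/= ur0.
  have {}ur0 : rsubmx u = 0.
    by apply/rowP => i; rewrite !mxE; apply/eqP; rewrite -[_ == _]negbK.
  rewrite -[u]hsubmxK ur0 in uA *.
  move: uA; rewrite /A mul_row_col mul0mx addr0 [lsubmx u]mx11_scalar.
  rewrite mul_scalar_mx => /eqP; rewrite scaler_eq0 (negbTE y0) orbF.
  by move=> /eqP ->; rewrite raddf0 row_mx0.
apply: (mulfI ui0); rewrite mulr0.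
pose a (j : 'I_(1 + k)) := u 0 j.
pose x (j : 'I_(1 + k)) := row j A.
have : f [eta v with i |-> \sum_(j < 1 + k) a j *: x j] = 0.
  rewrite -mulmx_sum_row uA.
  (* the empty sum in the slot i *)
  have := multilinear_sum v i (fun=> 0) (fun=> 0) fML.
  by move=> /(_ 0%N); rewrite !big_ord0.
rewrite multilinear_sum // (bigD1 (rshift 1 i)) //= big1 => [|j].
  rewrite addr0 => <-; congr (_ * _); rewrite /x /A rowKd rowK.
  by congr f; rewrite set_slot_id.
case: (split_ordP j) => l ->.
  rewrite (fy _ i) ?mulr0 //= eqxx.
  by rewrite /x /A rowKu; apply/rowP => q; rewrite mxE ord1.
move=> li; have il : i != l by apply: contraNneq li => ->.
rewrite (fA _ i l) ?mulr0 //= eqxx eq_sym (negbTE il).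
by rewrite /x /A rowKd rowK.
Qed.
End MultilinearAlgebra.

(** * Wedge products *)

Section Slots.
Context {T : Type} {I J : eqType}.

Lemma slot_comp (g : J -> I) (v : I -> T) j x :
  injective g ->
  [eta v with g j |-> x] \o g = [eta v \o g with j |-> x] :> (J -> T).
Proof. by move=> gI; apply/funext => l /=; rewrite (inj_eq gI). Qed.

Lemma slot_comp_notin (g : J -> I) (v : I -> T) i x :
  (forall j, g j != i) -> [eta v with i |-> x] \o g = v \o g.
Proof. by move=> gi; apply/funext => l /=; rewrite (negbTE (gi l)). Qed.
End Slots.

Section WedgeAlgebra.
Context {R : realType} {m : nat} {M : manifold R m}.
Local Notation V := 'rV[R]_m.

Section Wedge.
Context {k l : nat} (a : @form_family R m M k) (b : @form_family R m M l)
  (c : chart M) (p : M).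

(** In each term of the antisymmetrisation, the slot i of v is read by exactly
    one of the two factors. *)
Lemma wedge_multilinear :
  multilinear_form (a c p) -> multilinear_form (b c p) ->
  multilinear_form (wedge_form a b c p).
Proof.
move=> aML bML v i r x y; rewrite /wedge_form mulrCA -mulrDr; congr (_ * _).
rewrite mulr_sumr -big_split; apply: eq_bigr => s _ /=.
pose gl (j : 'I_k) := s (lshift l j); pose gr (j : 'I_l) := s (rshift k j).
have glI : injective gl by move=> j j' /perm_inj/lshift_inj.
have grI : injective gr by move=> j j' /perm_inj/rshift_inj.
have lrN j j' : gl j != gr j' by rewrite (inj_eq perm_inj) eq_lrshift.
pose fa z := a c p ([eta v with i |-> z] \o gl).
pose fb z := b c p ([eta v with i |-> z] \o gr).
change ((-1) ^+ s * (fa (r *: x + y) * fb (r *: x + y)) =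
  r * ((-1) ^+ s * (fa x * fb x)) + (-1) ^+ s * (fa y * fb y)).
rewrite [X in _ = X + _]mulrCA -mulrDr; congr (_ * _); rewrite /fa /fb.
have [j iE|j iE] := split_ordP ((s^-1)%g i).
  have -> : i = gl j by rewrite /gl -iE permKV.
  rewrite !(slot_comp _ _ _ glI) aML.
  rewrite !(slot_comp_notin (g := gr)) => [|j'|j'|j']; rewrite 1?eq_sym //.
  by rewrite mulrDl mulrA.
have -> : i = gr j by rewrite /gr -iE permKV.
rewrite !(slot_comp _ _ _ grI) bML !(slot_comp_notin (g := gl)) //.
by rewrite mulrDr mulrCA.
Qed.

(** Composing with the transposition of i and j preserves the terms of the
    antisymmetrisation at v and changes their signs. *)
Lemma wedge_alternating : alternating_form (wedge_form a b c p).
Proof.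
move=> v i j ij vij; rewrite /wedge_form; set S := (X in _ * X).
suff : S = - S.
  by move/eqP; rewrite -addr_eq0 -mulr2n mulrn_eq0 => /eqP ->; rewrite mulr0.
rewrite {1}/S (reindex_inj (mulIg (tperm i j))) -sumrN.
apply: eq_bigr => s _; rewrite odd_permM odd_tperm ij signr_addb mulrN1 mulNr.
have vt q : v ((s * tperm i j)%g q) = v (s q).
  by rewrite permM; case: tpermP => // ->.
by congr (- (_ * (a c p _ * b c p _))); apply/funext => q; rewrite vt.
Qed.

Lemma wedge_vanishes_on (y : V) :
  vanishes_on y (a c p) -> vanishes_on y (b c p) ->
  vanishes_on y (wedge_form a b c p).
Proof.
move=> ay yb v i vi; rewrite /wedge_form big1 ?mulr0 // => s _.
have [j iE|j iE] := split_ordP ((s^-1)%g i).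
  by rewrite (ay _ j) ?mul0r ?mulr0 // -iE permKV.
by rewrite (yb _ j) ?mulr0 // -iE permKV.
Qed.
End Wedge.

Lemma wedge_exp_multilinear k (w : @form_family R m M k) c p n :
  multilinear_form (w c p) -> multilinear_form (wedge_exp w n c p).
Proof.
move=> wML; elim: n => [|n IH]; first by move=> v [].
exact: wedge_multilinear.
Qed.

Lemma wedge_exp_vanishes_on k (w : @form_family R m M k) c p n y :
  vanishes_on y (w c p) -> vanishes_on y (wedge_exp w n c p).
Proof.
move=> wy; elim: n => [|n IH]; first by move=> v [].
exact: wedge_vanishes_on.
Qed.

End WedgeAlgebra.

(** * Contraction, exterior derivative and Lie derivative *)

Section Calculus.
Context {R : realType} {m : nat} {M : manifold R m}.
Local Notation V := 'rV[R]_m.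

Lemma form_multilinear k (w : kform M k) c p :
  chart_dom c p -> multilinear_form (form_comp w c p).
Proof. by move=> cp; case: (form_compP w) => _ + _ _; exact. Qed.

Lemma form_alternating k (w : kform M k) c p :
  chart_dom c p -> alternating_form (form_comp w c p).
Proof. by move=> cp; case: (form_compP w) => _ _ + _; exact. Qed.

Lemma in_chart_image (c : chart M) p :
  chart_dom c p -> (chart_map c @` chart_dom c) (chart_map c p).
Proof. by move=> cp; exists p. Qed.

Lemma local_exprE T (c : chart M) (f : M -> T) p :
  chart_dom c p -> local_expr c f (chart_map c p) = f p.
Proof. by move=> cp; rewrite /local_expr /= chart_mapK. Qed.

Lemma eq_local_expr T (c : chart M) (f g : M -> T) :
  (forall p, chart_dom c p -> f p = g p) ->
  {in chart_map c @` chart_dom c, local_expr c f =1 local_expr c g}.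
Proof.
by move=> fg y /set_mem[p cp <-]; rewrite !local_exprE //; exact: fg.
Qed.

Lemma derive_local_expr (W : normedModType R) (c : chart M) (f g : M -> W) p v :
  chart_dom c p -> (forall q, chart_dom c q -> f q = g q) ->
  'D_v (local_expr c f) (chart_map c p) = 'D_v (local_expr c g) (chart_map c p).
Proof.
move=> cp fg; apply: near_eq_derive.
apply: (eq_open_near _ _ (in_chart_image cp)); first exact: chart_image_open.
exact: eq_local_expr.
Qed.

Lemma form_local_differentiable k (w : kform M k) c p v :
  chart_dom c p ->
  differentiable (local_expr c (fun q => form_comp w c q v)) (chart_map c p).
Proof.
move=> cp; case: (form_compP w) => + _ _ _ => /(_ c v) sw.
exact: smooth_on_differentiable sw (in_chart_image cp).
Qed.

Lemma vect_local_differentiable (X : vect_field M) c p :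
  chart_dom c p ->
  differentiable (local_expr c (vect_comp X c)) (chart_map c p).
Proof.
move=> cp; case: (vect_compP X) => /(_ c) sX _.
exact: smooth_on_differentiable sX (in_chart_image cp).
Qed.

Lemma eq_ext_d k (w w' : @form_family R m M k) :
  form_eq w w' -> form_eq (ext_d w) (ext_d w').
Proof.
move=> ww' c p v cp; apply: eq_bigr => i _; congr (_ * _).
by apply: derive_local_expr => // q cq; exact: ww'.
Qed.

(** The slot i of dw is the direction of the derivative in the i-th term of
    the sum, and an argument of w in the other ones. *)
Lemma multilinear_ext_d k (w : kform M k) c p :
  chart_dom c p -> multilinear_form (ext_d w c p).
Proof.
move=> cp v i a x y; rewrite /ext_d mulr_sumr -big_split; apply: eq_bigr => j _.
rewrite /= mulrCA -mulrDr; congr (_ * _).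
have E z : (fun q => form_comp w c q (fun l => [eta v with i |-> z] (lift j l)))
  = (fun q => form_comp w c q ([eta v with i |-> z] \o lift j)) by [].
rewrite !E; case: (unliftP j i) => [l|] ->.
  have df u := form_local_differentiable w u cp.
  rewrite !(slot_comp _ _ _ lift_inj) (negbTE (neq_lift _ _)).
  rewrite (derive_local_expr (g := fun q =>
      a * form_comp w c q [eta v \o lift j with l |-> x]
        + form_comp w c q [eta v \o lift j with l |-> y])) //; last first.
    by move=> q cq; exact: form_multilinear.
  by apply: derive_linear_fun; exact: df.
rewrite eqxx !slot_comp_notin => [|l|l|l]; rewrite 1?eq_sym ?neq_lift //.
by rewrite !deriveE ?linearP //; exact: form_local_differentiable.
Qed.

Lemma smooth_in_contraction k (X : vect_field M) (w : kform M k.+1) c v :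
  smooth_in c (fun p => iprod X w c p v).
Proof.
have oU := @chart_image_open _ _ M c; have [sX _] := vect_compP X.
have [sw _ _ _] := form_compP w.
apply: eq_smooth_on (smooth_on_sum_mul oU
  (fun j => smooth_on_coord j oU (sX c))
  (fun j => sw c (vcons (delta_mx 0 j) v))).
  exact: oU.
move=> y /set_mem[p cp <-]; rewrite !local_exprE //.
under eq_bigr do rewrite local_exprE //.
by rewrite -vcons_coord //; exact: form_multilinear.
Qed.

Lemma is_form_contraction k (X : vect_field M) (w : kform M k.+1) :
  is_form (iprod X w).
Proof.
split=> [c v|c p cp|c p cp|c c' p v cp cp'].
- exact: smooth_in_contraction.
- exact/multilinear_vcons/form_multilinear.
- exact/alternating_vcons/form_alternating.
- have [_ _ _ wT] := form_compP w; have [_ XT] := vect_compP X.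
  rewrite /iprod (wT c c') //; congr (form_comp w c' p _); apply/funext => i.
  by case: (unlift ord0 i) => //=; rewrite -XT.
Qed.

Definition contraction k (X : vect_field M) (w : kform M k.+1) : kform M k :=
  KForm (is_form_contraction X w).

(** A 0-form has the same value at p in all charts around p; h is read in a
    chart chosen at each point. *)
Lemma form0_fun (f : kform M 0) :
  exists2 h : M -> R, smooth_fun h & form_eq f (form0 h).
Proof.
have [sf _ _ fT] := form_compP f.
pose v0 (i : 'I_0) : V := 0.
have v0E v : v = v0 by apply/funext; case.
pose cc (p : M) := projT1 (cid (chart_dom_cover p)).
have ccP p : chart_dom (cc p) p := projT2 (cid (chart_dom_cover p)).
have fh : form_eq f (form0 (fun p => form_comp f (cc p) p v0)).
  by move=> c p v cp; rewrite (fT c (cc p)) // [X in form_comp f _ _ X]v0E.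
exists (fun p => form_comp f (cc p) p v0) => // c.
apply: eq_smooth_on (sf c v0); first exact: chart_image_open.
by apply: eq_local_expr => p cp; exact: fh.
Qed.

(** Leibniz rule for w(X, u), on the expansion of X in the coordinate basis;
    the last term is that of a vector field with constant components. *)
Lemma derive_contraction k (X : vect_field M) (w : kform M k.+1) c p
    (u : 'I_k -> V) z :
  chart_dom c p ->
  'D_z (local_expr c (fun q => iprod X w c q u)) (chart_map c p) =
  form_comp w c p
    (vcons ('D_z (local_expr c (vect_comp X c)) (chart_map c p)) u) +
  'D_z (local_expr c (fun q => form_comp w c q (vcons (vect_comp X c p) u)))
    (chart_map c p).
Proof.
move=> cp; have wML q (cq : chart_dom c q) := form_multilinear w cq.
have dw v := form_local_differentiable w v cp.
have dX := vect_local_differentiable X cp.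
have dXj j := differentiable_coord_fun j dX.
rewrite (derive_local_expr (g := fun q =>
    \sum_(j < m) vect_comp X c q 0 j *
      form_comp w c q (vcons (delta_mx 0 j) u)))
  //; last first.
  by move=> q cq; rewrite /iprod -vcons_coord //; exact: wML.
rewrite [X in _ = _ + X](derive_local_expr (g := fun q =>
    \sum_(j < m) vect_comp X c p 0 j *
      form_comp w c q (vcons (delta_mx 0 j) u)))
  //; last first.
  by move=> q cq; rewrite -vcons_coord //; exact: wML.
rewrite [LHS](derive_sum_mul z dXj (fun j => dw _)).
rewrite [X in _ = _ + X](derive_sum_mul
  (f := fun j => cst (vect_comp X c p 0 j)) z
  (fun j => differentiable_cst _ _) (fun j => dw _)).
rewrite vcons_coord; last exact: wML.
rewrite -big_split; apply: eq_bigr => j _ /=.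
by rewrite derive_cst mul0r add0r derive_coord // !local_exprE.
Qed.

Lemma vcons_lift k (x : V) (v : 'I_k.+1 -> V) i :
  (fun j => vcons x v (lift (lift ord0 i) j)) = vcons x (v \o lift i).
Proof.
apply/funext => j; case: (unliftP ord0 j) => [l|] ->.
  rewrite vconsS (_ : lift _ _ = lift ord0 (lift i l)) ?vconsS //.
  by apply: ord_inj; rewrite /= /bump !add1n ltnS addnS.
by rewrite vcons0 (_ : lift _ _ = ord0) ?vcons0 //; apply: ord_inj.
Qed.

(** The terms of i_X dw where w is differentiated along v_i cancel with those
    of d(i_X w); the term along X and the derivatives of the components of X
    in d(i_X w) make up L_X w, after each D_(v_i) X is moved to the slot i. *)
Lemma cartan_formula k (X : vect_field M) (w : kform M k.+1) :
  form_eq (lie_d X w) (add_form (iprod X (ext_d w)) (ext_d (iprod X w))).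
Proof.
move=> c p v cp; have wML := form_multilinear w cp.
have wA := form_alternating w cp.
rewrite /lie_d /add_form {1}/iprod -/(vcons _ _) /ext_d.
rewrite [X in _ = X + _]big_ord_recl -[RHS]addrA.
congr (_ + _).
  rewrite expr0 mul1r vcons0; congr ('D_ _ (local_expr c _) _).
  apply/funext => q; congr (form_comp w c q _); apply/funext => j.
  by rewrite vconsS.
rewrite -big_split; apply: eq_bigr => i _ /=.
rewrite derive_contraction // alternating_move_slot // vconsS.
under [in X in _ = X + _]eq_fun do rewrite vcons_lift.
rewrite mulrDr mulrA -signr_odd -expr2 sqrr_sign mul1r.
by rewrite addrCA signr_odd exprS mulN1r mulNr [X in _ = _ + X]addNr addr0.
Qed.
End Calculus.

(** * Forms of degree 1 and 2 as matrices *)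

Section PointwiseForms.
Context {R : realType} {m : nat} {M : manifold R m}.
Local Notation V := 'rV[R]_m.

Lemma form1E (a : @form_family R m M 1) c p v :
  multilinear_form (a c p) -> a c p v = (v ord0 *m covector a c p) 0 0.
Proof.
move=> aML.
have cst_slot x : (fun=> x) = [eta v with ord0 |-> x] :> ('I_1 -> V).
  by apply/funext => i; rewrite /= ord1 eqxx.
rewrite (_ : v = fun=> v ord0) ?cst_slot ?multilinear_coord // ?mxE /=.
  by apply: eq_bigr => j _; rewrite mxE cst_slot.
by apply/funext => i; rewrite ord1.
Qed.

Lemma form2E (W : @form_family R m M 2) c p v :
  multilinear_form (W c p) ->
  W c p v = (v (lift ord0 ord0) *m flat_at W c p (v ord0)) 0 0.
Proof.
move=> WML; pose l1 : 'I_2 := lift ord0 ord0.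
rewrite -{1}(set_slot_id v l1) multilinear_coord // mxE.
apply: eq_bigr => j _; rewrite mxE; congr (_ * W c p _).
apply/funext => i /=; case: (unliftP ord0 i) => [l|] -> //.
by rewrite ord1 eqxx.
Qed.

Lemma flat_at_linear (W : @form_family R m M 2) c p a x y :
  multilinear_form (W c p) ->
  flat_at W c p (a *: x + y) = a *: flat_at W c p x + flat_at W c p y.
Proof.
move=> WML; apply/colP => j; rewrite !mxE.
have E z : (fun i : 'I_2 => if i == ord0 then z else delta_mx 0 j)
  = [eta (fun=> delta_mx 0 j) with ord0 |-> z] by [].
by rewrite !E WML.
Qed.

Lemma covector_contraction (X : vect_family (M := M))
    (W : @form_family R m M 2) c p :
  covector (iprod X W) c p = flat_at W c p (X c p).
Proof.
apply/colP => j; rewrite !mxE; congr (W c p _); apply/funext => i.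
by case: (unliftP ord0 i) => [l|] ->.
Qed.

Lemma eq_covector (a b : @form_family R m M 1) c p :
  chart_dom c p -> form_eq a b -> covector a c p = covector b c p.
Proof. by move=> cp ab; apply/colP => j; rewrite !mxE ab. Qed.

Lemma form1_vanishes_on (a : @form_family R m M 1) c p y :
  multilinear_form (a c p) -> y *m covector a c p = 0 ->
  vanishes_on y (a c p).
Proof.
move=> aML ay v i vi; have vy : v ord0 = y by rewrite -vi (ord1 i).
by rewrite form1E // vy ay mxE.
Qed.

Lemma form2_vanishes_on (W : @form_family R m M 2) c p y :
  multilinear_form (W c p) -> alternating_form (W c p) ->
  flat_at W c p y = 0 -> vanishes_on y (W c p).
Proof.
move=> WML WA Wy v i; have Wy0 u : u ord0 = y -> W c p u = 0.
  by move=> uy; rewrite form2E // uy Wy mulmx0 mxE.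
case: (unliftP ord0 i) => [l|] -> vi; last exact: Wy0.
have W01 := alternating_tperm v WML WA (neq_lift ord0 l).
by apply: oppr_inj; rewrite -W01 oppr0 Wy0 //= tpermL.
Qed.
End PointwiseForms.

(** * The splitting of the tangent spaces *)

(** By [vanishes_on_top_degree]: if y lies in both kernels, then
    omega /\ Omega^n vanishes as soon as one of its arguments is y. *)
Lemma regular_nondegenerate (R : realType) (n : nat)
    (M : manifold R (2 * n).+1) (om : kform M 1) (Om : kform M 2) c p y :
  nowhere_zero (wedge_form om (wedge_exp Om n)) -> chart_dom c p ->
  y *m covector om c p = 0 -> flat_at Om c p y = 0 -> y = 0.
Proof.
move=> nz cp omy Omy; have [v] := nz c p cp; apply: contraNeq => y0.
have omML := form_multilinear om cp; have OmML := form_multilinear Om cp.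
apply/eqP; apply: (vanishes_on_top_degree _ _ _ y0).
- by rewrite add1n mulnC.
- exact/wedge_multilinear/wedge_exp_multilinear.
- exact: wedge_alternating.
- apply: wedge_vanishes_on; first exact: form1_vanishes_on.
  exact/wedge_exp_vanishes_on/form2_vanishes_on/Omy/form_alternating.
Qed.

Section DualPair.
Context {R : realType} {n : nat} {M : manifold R (2 * n).+1}.
Context {om : kform M 1} {Om : kform M 2} {E : vect_field M}
  {L : bivect_field M}.
Context (reg : regular_acc_structure om Om) (dual : dual_pair om Om E L).
Context {c : chart M} {p : M} (cp : chart_dom c p).
Local Notation flat := (flat_at Om c p).
Local Notation sharp_p := (sharp_at L c p).
Local Notation omega := (covector om c p).
Local Notation Reeb := (vect_comp E c p).

Lemma sharp_skew (a b : 'cV[R]_(2 * n).+1) :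
  sharp_p a *m b = - (sharp_p b *m a)^T.
Proof.
have [_ LT _] := bivect_compP L.
by rewrite /sharp_at !trmx_mul trmxK LT // mulNmx mulmxN opprK mulmxA.
Qed.

(** i_omega Lambda = 0 fills the first slot of Lambda with omega, whereas
    omega(a^sharp) fills the second one. *)
Lemma omega_sharp a : sharp_p a *m omega = 0.
Proof.
have [_ _ _ sharp_om] := dual.
have := sharp_om c p cp; rewrite sharp_skew /sharp => ->.
by rewrite mul0mx trmx0 oppr0.
Qed.

Lemma omega_Reeb : (Reeb *m omega) 0 0 = 1.
Proof.
have [_ /(_ c p (fun=> 0) cp) + _ _] := dual.
by rewrite /iprod form1E; [rewrite /= unlift_none|exact: form_multilinear].
Qed.

Lemma flat_Reeb : flat Reeb = 0.
Proof.
have [_ _ EOm _] := dual; rewrite -covector_contraction.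
by rewrite (eq_covector cp EOm); apply/colP => j; rewrite !mxE.
Qed.

Lemma flat_sharp_flat y : flat (sharp_p (flat y)) = flat y.
Proof.
by have [/(_ c p cp)[_ +] _ _ _] := dual; apply; rewrite inE; exists y.
Qed.

Lemma sharp_flat_sharp a : sharp_p (flat (sharp_p a)) = sharp_p a.
Proof.
by have [/(_ c p cp)[+ _] _ _ _] := dual; apply; rewrite inE; exists a.
Qed.

(** The difference of both sides is in the kernels of omega and of
    Omega^flat. *)
Lemma tangent_splitting y : y = sharp_p (flat y) + (y *m omega) 0 0 *: Reeb.
Proof.
have OmML := form_multilinear Om cp.
apply/eqP; rewrite -subr_eq0; apply/eqP.
apply: (regular_nondegenerate reg.2 cp); set r := (y *m omega) 0 0.
  rewrite mulmxBl mulmxDl omega_sharp add0r -scalemxAl.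
  rewrite [Reeb *m _]mx11_scalar omega_Reeb [y *m _]mx11_scalar.
  by rewrite scalemx1 subrr.
rewrite addrC -scaleN1r flat_at_linear // addrC [sharp_p _ + _]addrC.
rewrite flat_at_linear // flat_Reeb scaler0 add0r flat_sharp_flat.
by rewrite scaleN1r subrr.
Qed.

(** The difference b of both sides satisfies b(E) = 0 and b^sharp = 0; by
    skew-symmetry of Lambda, it then vanishes on the image of Lambda^sharp,
    hence everywhere by [tangent_splitting]. *)
Lemma flat_sharp_annihilator (a : 'cV[R]_(2 * n).+1) :
  Reeb *m a = 0 -> flat (sharp_p a) = a.
Proof.
move=> aE; apply/eqP; rewrite -subr_eq0; apply/eqP; set b := _ - a.
have bE : Reeb *m b = 0.
  have OmML := form_multilinear Om cp.
  rewrite mulmxBr aE subr0.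
  have EV := form2_vanishes_on OmML (form_alternating Om cp) flat_Reeb.
  have := EV (vcons (sharp_p a) (fun=> Reeb)) (lift ord0 ord0).
  rewrite form2E // vcons0 vconsS => sE.
  by rewrite [Reeb *m _]mx11_scalar sE // raddf0.
have sb : sharp_p b = 0.
  rewrite /sharp_at raddfB mulmxBl -!/(sharp_at _ _ _ _).
  by rewrite sharp_flat_sharp subrr.
apply/row_matrixP => i; rewrite row0 rowE [delta_mx _ _]tangent_splitting.
by rewrite mulmxDl -scalemxAl bE scaler0 addr0 sharp_skew sb mul0mx trmx0 oppr0.
Qed.

End DualPair.

(** * Infinitesimal symmetries *)

Section Symmetries.
Context {R : realType} {m : nat} {M : manifold R m}.

Lemma lie_d_closed k (X : vect_field M) (w : kform M k.+1)
    (a : @form_family R m M k) :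
  closed_form w -> form_eq (iprod X w) a -> form_eq (lie_d X w) (ext_d a).
Proof.
move=> wcl wa c p v cp; rewrite cartan_formula // /add_form.
by rewrite {1}/iprod wcl // add0r; exact: eq_ext_d.
Qed.

(** For w = omega and b = h, the right-hand side is the left-hand side of the
    equation on h. *)
Lemma lie_d_pair_vect k (X E : vect_field M) (L : @bivect_family R m M)
    (a : @form_family R m M 1) h (w : kform M k.+1) (b : @form_family R m M k) :
  vect_eq X (pair_vect E L a h) -> form_eq (iprod X w) b ->
  form_eq (lie_d X w)
    (add_form (add_form (iprod (sharp L a) (ext_d w))
                        (scale_form h (iprod E (ext_d w))))
              (ext_d b)).
Proof.
move=> XE wb c p v cp; rewrite cartan_formula // /add_form.
rewrite (eq_ext_d wb) //; congr (_ + _).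
rewrite /scale_form /iprod -!/(vcons _ _) XE // /pair_vect addrC.
have := multilinear_ext_d w cp (vcons 0 v) ord0 (h p) (vect_comp E c p)
  (sharp L a c p).
by rewrite !vcons_slot0 => ->; rewrite addrC.
Qed.
End Symmetries.

Theorem theorem2p10 (R : realType) (n : nat) (M : manifold R (2 * n).+1)
    (omega : kform M 1) (Omega : kform M 2)
    (E : vect_field M) (Lambda : bivect_field M) :
  regular_acc_structure omega Omega ->
  dual_pair omega Omega E Lambda ->
  forall X : vect_field M,
    infinitesimal_symmetry omega Omega X <->
    exists (alpha : kform M 1) (h : M -> R),
      [/\ closed_form alpha,
          form_eq (iprod E alpha) (@zero_form R _ M 0),
          smooth_fun h,
          form_eq
            (add_form
              (add_form (iprod (sharp Lambda alpha) (ext_d omega))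
                        (scale_form h (iprod E (ext_d omega))))
              (ext_d (form0 h)))
            (@zero_form R _ M 1) &
          vect_eq X (pair_vect E Lambda alpha h)].
Proof.
move=> reg dual X; have [Omcl _] := reg.
have omML c p (cp : chart_dom c p) := form_multilinear omega cp.
have OmML c p (cp : chart_dom c p) := form_multilinear Omega cp.
split=> [[Lom LOm]|[alpha [h [acl aE _ eq_h XE]]]].
  have [h sh hE] := form0_fun (contraction X omega).
  have XE : vect_eq X (pair_vect E Lambda (contraction X Omega) h).
    move=> c p cp; rewrite [LHS](tangent_splitting reg dual cp).
    rewrite /pair_vect /sharp covector_contraction; congr (_ + _ *: _).
    rewrite -[RHS]/(form0 h c p (fun=> 0)) -hE //=.
    by rewrite /iprod form1E ?unlift_none //; exact: omML.
  exists (contraction X Omega), h; split=> // [c p v cp|c p v cp|c p v cp].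
  - by rewrite -(lie_d_closed (X := X) Omcl (fun _ _ _ _ => erefl)) // LOm.
  - have EV := form2_vanishes_on (OmML c p cp) (form_alternating Omega cp)
      (flat_Reeb dual cp).
    rewrite /zero_form -[LHS]/(form_comp Omega c p
      (vcons (vect_comp X c p) (vcons (vect_comp E c p) v))).
    by rewrite (EV _ (lift ord0 ord0)) // vconsS vcons0.
  - by rewrite -(lie_d_pair_vect XE hE) // Lom.
have XOm : form_eq (iprod X Omega) alpha.
  move=> c p v cp; rewrite [LHS]form1E; last exact/multilinear_vcons/OmML.
  have aML := form_multilinear alpha cp.
  rewrite [RHS]form1E // covector_contraction XE // /pair_vect addrC.
  rewrite flat_at_linear ?(flat_Reeb dual cp) ?scaler0 ?add0r; last exact: OmML.
  rewrite /sharp (flat_sharp_annihilator reg dual cp) //.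
  apply/matrixP => i j; rewrite !ord1 [RHS]mxE.
  by have := aE c p (fun=> 0) cp; rewrite /iprod form1E ?unlift_none.
have Xom : form_eq (iprod X omega) (form0 h).
  move=> c p v cp; rewrite /iprod form1E ?unlift_none /=; last exact: omML.
  rewrite XE // /pair_vect mulmxDl (omega_sharp dual cp) add0r -scalemxAl mxE.
  by rewrite (omega_Reeb dual cp) mulr1.
split=> c p v cp; first by rewrite (lie_d_pair_vect XE Xom) // eq_h.
by rewrite (lie_d_closed Omcl XOm) // acl.
Qed.
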